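(* Let $(A,\wedge,1)$ be a bounded semilattice, endowed with the hemiimplicative semilattice structure $(A,\wedge,\to,1)$ in which $a\to b=1$ if $a=b$ and $a\to b=b$ if $a\neq b$. Let $F$ be a filter of $(A,\wedge,\to,1)$. Then $F$ is congruent if and only if it satisfies the following conditions for every $x,y\in A$ and $f\in F$: (1) If $x\neq y$ and $x\wedge f=y\wedge f$, then $y\in F$. (2) If $x\neq y$, $x\wedge f\neq y\wedge f$ and $y\not\leq f$, then $y\in F$.
   Context: A bounded semilattice $(A,\wedge,1)$ is a meet-semilattice with greatest element $1$, ordered by $a\le b$ iff $a\wedge b=a$. A hemiimplicative semilattice is an algebra $(A,\wedge,\to,1)$ such that $(A,\wedge,1)$ is a bounded semilattice, $a\to a=1$ for all $a$, and $a\le b\to c$ implies $a\wedge b\le c$. In it, $a\leftrightarrow b:=(a\to b)\wedge(b\to a)$ and $t(a,b,f):=(a\to b)\leftrightarrow((a\wedge f)\to(b\wedge f))$. A filter is a subset $F\subseteq A$ with $1\in F$, closed under $\wedge$, and upward closed. A filter $F$ is congruent if $t(a,b,f)\in F$ for every $a,b\in A$ and $f\in F$. *)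

(* Defs.v *)
From HB Require Import structures.
From mathcomp Require Import all_boot all_order.
From mathcomp Require Import boolp classical_sets.

Set Implicit Arguments.
Unset Strict Implicit.
Unset Printing Implicit Defensive.

Import Order.Theory.
Local Open Scope order_scope.

Reserved Notation "a ~> b" (at level 60, right associativity).
Reserved Notation "a <~> b" (at level 65, no associativity).

(* A bounded semilattice (A, /\, 1) is a tMeetSemilatticeType: the meet is
   `&`, the greatest element is \top, and a <= b iff a `&` b = a (leEmeet). *)
HB.mixin Record isHemiimplicative d A of Order.TMeetSemilattice d A := {
  himp : A -> A -> A;
  himpxx : forall a : A, himp a a = \top;
  le_himp_meet : forall a b c : A, a <= himp b c -> a `&` b <= c
}.

#[short(type="hemiimplicativeType")]
HB.structure Definition Hemiimplicative d :=
  { A of Order.TMeetSemilattice d A & isHemiimplicative d A }.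

Notation "a ~> b" := (himp a b) : order_scope.

Definition hiff d (A : hemiimplicativeType d) (a b : A) : A :=
  (a ~> b) `&` (b ~> a).

Notation "a <~> b" := (hiff a b) : order_scope.

Definition tterm d (A : hemiimplicativeType d) (a b f : A) : A :=
  (a ~> b) <~> ((a `&` f) ~> (b `&` f)).

Definition is_filter d (A : tMeetSemilatticeType d) (F : set A) : Prop :=
  [/\ F \top,
      forall a b : A, F a -> F b -> F (a `&` b) &
      forall a b : A, a <= b -> F a -> F b].

Definition is_congruent d (A : hemiimplicativeType d) (F : set A) : Prop :=
  forall a b f : A, F f -> F (tterm a b f).

(* An alias of A, so that this implication is not attached to every bounded
   semilattice (a given A may carry other hemiimplicative structures). *)
Definition eqimp d (A : tMeetSemilatticeType d) : Type := A.

Section EqImp.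
Context d (A : tMeetSemilatticeType d).

HB.instance Definition _ := Order.TMeetSemilattice.on (eqimp A).

Definition eq_himp (a b : eqimp A) : eqimp A := if a == b then \top else b.

Lemma eq_himpxx (a : eqimp A) : eq_himp a a = \top.
Proof. by rewrite /eq_himp eqxx. Qed.

Lemma le_eq_himp_meet (a b c : eqimp A) : a <= eq_himp b c -> a `&` b <= c.
Proof.
rewrite /eq_himp; case: eqP => [-> _|_ le_ac]; first exact: leIr.
exact: le_trans (leIl _ _) le_ac.
Qed.

HB.instance Definition _ :=
  isHemiimplicative.Build d (eqimp A) eq_himpxx le_eq_himp_meet.

End EqImp.

(* Main.v *)
Require Import Defs.
From mathcomp Require Import all_boot all_order.
From mathcomp Require Import boolp classical_sets.
Import Order.Theory.
Local Open Scope order_scope.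

(* Evaluating [t(x, y, f)] gives [1] when [x = y], [y] when [x /\ f = y /\ f]
   with [x <> y], and otherwise [1] or [y /\ f] according to whether [y <= f].
   As [f] lies in [F], membership of [y /\ f] in [F] amounts to that of [y]. *)

Lemma himp_eqimpE (d : Order.disp_t) (A : tMeetSemilatticeType d)
    (a b : eqimp A) : a ~> b = if a == b then \top else b.
Proof. by []. Qed.

(** Between distinct elements each implication returns its conclusion. *)
Lemma hiff_eqimpE (d : Order.disp_t) (A : tMeetSemilatticeType d)
    (a b : eqimp A) : a <~> b = if a == b then \top else a `&` b.
Proof.
rewrite /hiff !himp_eqimpE [b == a]eq_sym.
by case: (a == b); rewrite ?meetxx // meetC.
Qed.

Lemma tterm_eqimpE (d : Order.disp_t) (A : tMeetSemilatticeType d)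
    (x y f : eqimp A) :
  tterm x y f =
    if x == y then \top
    else if x `&` f == y `&` f then y
    else if y <= f then \top else y `&` f.
Proof.
rewrite /tterm !himp_eqimpE.
have [->|_] := eqVneq x y; first by rewrite eqxx hiff_eqimpE eqxx.
have [_|_] := eqVneq (x `&` f) (y `&` f); rewrite hiff_eqimpE.
  (* The term is now [y <~> \top], which equals [y] even when [y = \top]. *)
  by rewrite meetx1; case: eqP => [->|].
(* The sides [y] and $y \wedge f$ coincide exactly when [y <= f]. *)
by rewrite eq_sym -leEmeet meetA meetxx.
Qed.

Theorem proposition4p7 (d : Order.disp_t) (A : tMeetSemilatticeType d)
    (F : set (eqimp A)) (hF : is_filter F) :
  is_congruent F <->
  (forall x y f : eqimp A, F f ->
     (x <> y -> x `&` f = y `&` f -> F y) /\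
     (x <> y -> x `&` f <> y `&` f -> ~ (y <= f) -> F y)).
Proof.
case: hF => F1 FI Fup; split => [congF x y f Ff | condF x y f Ff].
  have := congF x y f Ff; rewrite tterm_eqimpE => Ft.
  split=> [/eqP/negPf nxy exy | /eqP/negPf nxy /eqP/negPf nxyf /negP/negPf nyf].
    by move: Ft; rewrite nxy exy eqxx.
  by move: Ft; rewrite nxy nxyf nyf; apply: Fup; exact: leIl.
have [cond1 cond2] := condF x y f Ff; rewrite tterm_eqimpE.
case: eqP => // nxy; case: eqP => [|nxyf]; first exact: cond1.
(* If [y <= f] the value is [\top], in [F] by [F1]; otherwise [F y] and [F f] give the meet. *)
case: ifP => // /negP nyf; exact: FI (cond2 nxy nxyf nyf) Ff.
Qed.
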